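(* Let $G$ be the group of order 18 presented by generators $x_1,x_2,a$ and relations $a^2=1$, $x_1^3=x_2^3=1$, $x_1x_2=x_2x_1$, $a x_i a^{-1}=x_i^{-1}$ $(i=1,2)$, and let $H=R(G)$ be its representation group of order 54 described in the context. Let $\varepsilon=1$ or $\varepsilon=-1$. Then every irreducible representation of spin type $\chi_\varepsilon$ of $G$, i.e. every irreducible complex linear representation $\Pi$ of $H$ with $\Pi(z_{12})=\omega^\varepsilon I$, is equivalent to one of $R_{\varepsilon;k}$, $k=0,1$.
   Context: Let $\omega=\exp(2\pi i/3)$. $H=R(G)$ is the group generated by $\xi_1,\xi_2,z_{12},w$ with fundamental relations $\xi_1^3=\xi_2^3=1$, $z_{12}^3=1$, $w^2=1$, $z_{12}$ central, $\xi_2\xi_1=z_{12}^{-1}\xi_1\xi_2$, $w\xi_iw^{-1}=\xi_i^{-1}$ $(i=1,2)$. It is a central extension of $G$ by $\langle z_{12}\rangle\cong C_3$ via $\xi_i\mapsto x_i$, $w\mapsto a$, $z_{12}\mapsto 1$. Irreducible spin (projective) representations of $G$ are obtained from irreducible linear representations $\Pi$ of $R(G)$; the spin type of $\Pi$ is the character $\chi$ of $\langle z_{12}\rangle$ such that $\Pi(z)=\chi(z)I$ for $z\in\langle z_{12}\rangle$, and $\chi_\varepsilon$ denotes the character with $\chi_\varepsilon(z_{12})=\omega^\varepsilon$. For $\varepsilon=\pm1$ and $k\in\{0,1\}$, $R_{\varepsilon;k}$ is the 3-dimensional representation of $H$ given by $$R_{\varepsilon;k}(z_{12})=\omega^\varepsilon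 I_3,\quad R_{\varepsilon;k}(\xi_1)=\begin{bmatrix}\omega^\varepsilon&0&0\\0&1&0\\0&0&\omega^{-\varepsilon}\end{bmatrix},\quad R_{\varepsilon;k}(\xi_2)=\begin{bmatrix}0&1&0\\0&0&1\\1&0&0\end{bmatrix},\quad R_{\varepsilon;k}(w)=(-1)^k\begin{bmatrix}0&0&1\\0&1&0\\1&0&0\end{bmatrix}.$$ *)

(* Defs.v *)
From mathcomp Require Import all_boot all_order all_algebra all_fingroup.
From mathcomp Require Import mxrepresentation complex.
From mathcomp Require Import reals trigo.

Set Implicit Arguments.
Unset Strict Implicit.
Unset Printing Implicit Defensive.

Import GRing.Theory Num.Theory.

(* [K \isog Grp (...)] leaves the generators anonymous. As the presented groups
   here are finite, a tuple that generates K and satisfies the relations is the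
   image of the formal generators under an isomorphism, so adding the first two
   clauses to the presentation names the generators. *)
Section Presentations.

Local Open Scope group_scope.

Definition presented_G (gT : finGroupType) (G : {group gT}) (x1 x2 a : gT) :
    Prop :=
  [/\ G :=: <<[set x1; x2; a]>>,
      [/\ a ^+ 2 = 1, x1 ^+ 3 = 1, x2 ^+ 3 = 1 & x1 * x2 = x2 * x1] /\
      (a * x1 * a^-1 = x1^-1 /\ a * x2 * a^-1 = x2^-1) &
      G \isog Grp (x1 : x2 : a :
        (a ^+ 2 = 1, x1 ^+ 3 = 1, x2 ^+ 3 = 1, x1 * x2 = x2 * x1,
         a * x1 * a^-1 = x1^-1, a * x2 * a^-1 = x2^-1))].

Definition presented_RG (hT : finGroupType) (H : {group hT})
    (xi1 xi2 z12 w : hT) : Prop :=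
  [/\ H :=: <<[set xi1; xi2; z12; w]>>,
      [/\ xi1 ^+ 3 = 1, xi2 ^+ 3 = 1, z12 ^+ 3 = 1 & w ^+ 2 = 1] /\
      [/\ z12 * xi1 = xi1 * z12, z12 * xi2 = xi2 * z12 & z12 * w = w * z12] /\
      [/\ xi2 * xi1 = z12^-1 * xi1 * xi2,
          w * xi1 * w^-1 = xi1^-1 & w * xi2 * w^-1 = xi2^-1] &
      H \isog Grp (xi1 : xi2 : z12 : w :
        (xi1 ^+ 3 = 1, xi2 ^+ 3 = 1, z12 ^+ 3 = 1, w ^+ 2 = 1,
         z12 * xi1 = xi1 * z12, z12 * xi2 = xi2 * z12, z12 * w = w * z12,
         xi2 * xi1 = z12^-1 * xi1 * xi2,
         w * xi1 * w^-1 = xi1^-1, w * xi2 * w^-1 = xi2^-1))].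

End Presentations.

Local Open Scope ring_scope.
Local Open Scope complex_scope.

(* exp(2 pi i / 3) *)
Definition omega (R : realType) : R[i] :=
  cos (2 * pi / 3) +i* sin (2 * pi / 3).

Definition mx3 (K : nzRingType) (rows : seq (seq K)) : 'M[K]_3 :=
  \matrix_(i, j) nth 0 (nth [::] rows i) j.

Definition is_R_rep (R : realType) (hT : finGroupType) (H : {group hT})
    (xi1 xi2 z12 w : hT) (eps : int) (k : nat)
    (rho : mx_representation R[i] H 3) : Prop :=
  let o := omega R in
  [/\ rho z12 = (o ^ eps)%:M,
      rho xi1 = mx3 [:: [:: o ^ eps; 0; 0];
                        [:: 0;       1; 0];
                        [:: 0;       0; o ^ (- eps)]],
      rho xi2 = mx3 [:: [:: 0; 1; 0];
                        [:: 0; 0; 1];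
                        [:: 1; 0; 0]] &
      rho w = (-1) ^+ k *: mx3 [:: [:: 0; 0; 1];
                                   [:: 0; 1; 0];
                                   [:: 1; 0; 0]]].

(* Main.v *)
(** For an irreducible representation of [H] of spin type [chi_eps], put
    [q = omega ^ eps] and let [X], [Y], [W] be the images of [xi1], [xi2], [w].
    As [Y] permutes the three eigenspaces of [X] cyclically, the eigenvalue [1]
    occurs, and [W] acts on that eigenspace as an involution; so some row
    vector [v <> 0] satisfies [v X = v] and [v W = (-1)^k v].  Then [v Y^2],
    [v], [v Y] are eigenvectors of [X] for the distinct eigenvalues [q], [1],
    [q^-1], and their span is stable under [H].  By irreducibility they form a
    basis, in which [X], [Y], [W] take the matrices of [R_{eps;k}]. *)

Require Import Defs.
From mathcomp Require Import all_boot all_order all_algebra all_fingroup.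
From mathcomp Require Import mxrepresentation complex.
From mathcomp Require Import reals trigo.
From mathcomp Require Import ring lra.

Set Implicit Arguments.
Unset Strict Implicit.
Unset Printing Implicit Defensive.

Import Order.TTheory GRing.Theory Num.Theory.

Local Open Scope ring_scope.
Local Open Scope complex_scope.

(** * Matrices with three rows, and the primitive cube root of unity *)

Lemma big_ord3 (V : nmodType) (f : 'I_3 -> V) :
  \sum_(i < 3) f i = f 0 + f 1 + f 2.
Proof.
by rewrite !big_ord_recl big_ord0 addr0 addrA; congr (f _ + f _ + f _);
   apply: val_inj.
Qed.

Lemma row_mx3 (F : nzRingType) (n : nat) (a b c : seq F) (A : 'M[F]_(3, n)) :
  [/\ row 0 (mx3 [:: a; b; c] *m A) =
        a`_0 *: row 0 A + a`_1 *: row 1 A + a`_2 *: row 2 A,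
      row 1 (mx3 [:: a; b; c] *m A) =
        b`_0 *: row 0 A + b`_1 *: row 1 A + b`_2 *: row 2 A &
      row 2 (mx3 [:: a; b; c] *m A) =
        c`_0 *: row 0 A + c`_1 *: row 1 A + c`_2 *: row 2 A].
Proof.
by split; rewrite row_mul mulmx_sum_row big_ord3 !mxE.
Qed.

Lemma ord3_ind (P : 'I_3 -> Prop) : P 0 -> P 1 -> P 2 -> forall i, P i.
Proof.
move=> P0 P1 P2 [[|[|[|//]]] lti].
- by rewrite (_ : Ordinal lti = 0) //; apply: val_inj.
- by rewrite (_ : Ordinal lti = 1) //; apply: val_inj.
- by rewrite (_ : Ordinal lti = 2) //; apply: val_inj.
Qed.

Lemma row3P (T : Type) (n : nat) (A B : 'M[T]_(3, n)) :
  row 0 A = row 0 B -> row 1 A = row 1 B -> row 2 A = row 2 B -> A = B.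
Proof. by move=> e0 e1 e2; apply/row_matrixP; apply: ord3_ind. Qed.

(** For [t] a third of a full turn, [cos (3 t) = 1] leaves only [1] and [-1/2] for [cos t], and
    [sin t > 0] excludes [1]. *)
Lemma omega_cyclotomic (R : realType) : omega R ^+ 2 + omega R + 1 = 0.
Proof.
rewrite /omega; set t := 2 * pi / 3.
have s_gt0 : 0 < sin t.
  by apply: sin_gt0_pi; have := pi_gt0 R; rewrite /t => ?; apply/andP; split; lra.
have E : t + t + t = pi *+ 2 by rewrite /t; field.
have Hc := congr1 cos E; have Hs := congr1 sin E.
move: Hc Hs; rewrite cos2pi sin2pi !(cosD, sinD) => Hc Hs.
have N := cos2Dsin2 t.
move: s_gt0 Hc Hs N; move: (sin t) (cos t) => s c s_gt0 Hc Hs N.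
have s2E : s ^+ 2 = 1 - c ^+ 2 by rewrite -N; ring.
have cE : c = - (1 / 2).
  (* The triple angle formula gives [4 c^3 - 3 c - 1 = 0], whose left side factors this way. *)
  have H : (c - 1) * (2 * c + 1) ^+ 2 = 0.
    transitivity (((c * c - s * s) * c - (s * c + c * s) * s) - 1
                  + 3 * c * (s ^+ 2 - (1 - c ^+ 2))); first by ring.
    by rewrite Hc s2E; ring.
  move/eqP: H; rewrite mulf_eq0 expf_eq0 /= => /orP[|] /eqP c1; last lra.
  by exfalso; nra.
by rewrite expr2; apply/eqP; rewrite eq_complex /=; apply/andP; split; apply/eqP;
   nra.
Qed.

(** * Clock and shift matrices with an inverting involution *)

Section ClockShift.

Variables (F : numFieldType) (n : nat) (q : F).
Hypothesis q_cyc : q ^+ 2 + q + 1 = 0.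

Lemma cyclotomic3_cube : q ^+ 3 = 1.
Proof.
apply/eqP; rewrite -subr_eq0; apply/eqP.
by transitivity ((q - 1) * (q ^+ 2 + q + 1)); [ring | rewrite q_cyc mulr0].
Qed.

Lemma cyclotomic3_inv : q^-1 = q ^+ 2.
Proof.
have q3 := cyclotomic3_cube.
have q0 : q != 0 by apply: contra_eq_neq q3 => ->; rewrite expr0n /= eq_sym oner_eq0.
by apply: (mulfI q0); rewrite mulfV // -exprS q3.
Qed.

(* The projections to the three eigenspaces recover each component. *)
Lemma cyclotomic3_eigen_independent (a b c : 'rV[F]_n) :
  a + b + c = 0 -> q *: a + b + q ^+ 2 *: c = 0 ->
  q ^+ 2 *: a + b + q *: c = 0 -> [/\ a = 0, b = 0 & c = 0].
Proof.
move=> h0 h1 h2.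
have n3 : (3 : F) != 0 by rewrite pnatr_eq0.
have q3 := cyclotomic3_cube.
have e0 j : a 0 j + b 0 j + c 0 j = 0 by move/rowP/(_ j): h0; rewrite !mxE.
have e1 j : q * a 0 j + b 0 j + q ^+ 2 * c 0 j = 0.
  by move/rowP/(_ j): h1; rewrite !mxE.
have e2 j : q ^+ 2 * a 0 j + b 0 j + q * c 0 j = 0.
  by move/rowP/(_ j): h2; rewrite !mxE.
have b0 : b = 0.
  apply/rowP => j; rewrite mxE; apply: (mulfI n3); rewrite mulr0.
  transitivity ((a 0 j + b 0 j + c 0 j) + (q * a 0 j + b 0 j + q ^+ 2 * c 0 j)
    + (q ^+ 2 * a 0 j + b 0 j + q * c 0 j)
    - (q ^+ 2 + q + 1) * (a 0 j + c 0 j)); first by ring.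
  by rewrite e0 e1 e2 q_cyc; ring.
have a0 : a = 0.
  apply/rowP => j; rewrite mxE; apply: (mulfI n3); rewrite mulr0.
  (* The weights [1], [q ^+ 2], [q] undo the factors on [a]; the subtracted terms all vanish since
     [q ^+ 3 = 1] and [q ^+ 2 + q + 1 = 0]. *)
  transitivity ((a 0 j + b 0 j + c 0 j)
    + q ^+ 2 * (q * a 0 j + b 0 j + q ^+ 2 * c 0 j)
    + q * (q ^+ 2 * a 0 j + b 0 j + q * c 0 j)
    - (q ^+ 2 + q + 1) * (b 0 j) - (q ^+ 2 + q * q ^+ 3 + 1) * c 0 j
    - 2 * (q ^+ 3 - 1) * a 0 j); first by ring.
  by rewrite e0 e1 e2 q3 mulr1 q_cyc; ring.
by split=> //; move: h0; rewrite a0 b0 !add0r.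
Qed.

Variables X Y W : 'M[F]_n.
Hypotheses (X3 : X *m X *m X = 1%:M) (Y3 : Y *m Y *m Y = 1%:M).
Hypotheses (W2 : W *m W = 1%:M) (XY : X *m Y = q *: (Y *m X)).
Hypotheses (WX : W *m X = X *m X *m W) (WY : W *m Y = Y *m Y *m W).

Let mulmxY_eq0 (m : nat) (B : 'M_(m, n)) : B *m Y = 0 -> B = 0.
Proof. by move=> BY; rewrite -[B]mulmx1 -Y3 !mulmxA BY !mul0mx. Qed.

(** [P = 1 + X + X^2] is three times the projection onto the fixed space of [X]. It is nonzero and
    commutes with [W], so [v] can be taken in the row space of [P (1 + W)] or [P (1 - W)]. *)
Lemma clock_shift_fixed_vector :
  (0 < n)%N ->
  exists (k : 'I_2) (v : 'rV[F]_n),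
    [/\ v != 0, v *m X = v & v *m W = (-1) ^+ k *: v].
Proof.
move=> n_gt0; pose P := 1%:M + X + X *m X.
have q3 := cyclotomic3_cube.
have YX : Y *m X = q ^+ 2 *: (X *m Y) by rewrite XY scalerA -exprSr q3 scale1r.
have PX : P *m X = P.
  by rewrite !mulmxDl X3 mul1mx addrC addrA.
have P0 : P != 0.
  apply/eqP => P0.
  (* [P], [Y P Y^-1] and [Y^2 P Y^-2] add up to [3]. *)
  have YXX : Y *m (X *m X) = q *: (X *m X *m Y).
    rewrite mulmxA YX -scalemxAl -mulmxA YX -scalemxAr scalerA -exprD.
    by rewrite (exprS q 3) q3 mulr1 mulmxA.
  have YP : (1%:M + q ^+ 2 *: X + q *: (X *m X)) *m Y = 0.
    transitivity (Y *m P); last by rewrite P0 mulmx0.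
    by rewrite !(mulmxDl, mulmxDr) YX YXX mulmx1 mul1mx -!scalemxAl.
  have YYP : (1%:M + q *: X + q ^+ 2 *: (X *m X)) *m Y *m Y = 0.
    transitivity (Y *m ((1%:M + q ^+ 2 *: X + q *: (X *m X)) *m Y)).
      rewrite mulmxA; congr (_ *m Y).
      rewrite !(mulmxDl, mulmxDr) -!scalemxAr YX YXX mulmx1 mul1mx -!scalemxAl.
      by rewrite !scalerA -exprD (exprS q 3) q3 mulr1 expr2.
    by rewrite YP mulmx0.
  have A1 : 1%:M + q ^+ 2 *: X + q *: (X *m X) = 0.
    exact: mulmxY_eq0.
  have A2 : 1%:M + q *: X + q ^+ 2 *: (X *m X) = 0.
    exact/mulmxY_eq0/mulmxY_eq0.
  (* [0 < n] provides a diagonal entry, at which the sum of the three identities reads [3 = 0]. *)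
  pose i := Ordinal n_gt0.
  have /matrixP/(_ i i) := A1; have /matrixP/(_ i i) := A2.
  have /matrixP/(_ i i) := P0; rewrite /P.
  rewrite !mxE eqxx /=; move: (\sum_j _) (X i i) => b a E0 E1 E2.
  have : (3 : F) = 0.
    transitivity ((1 + a + b) + (1 + q * a + q ^+ 2 * b)
      + (1 + q ^+ 2 * a + q * b) - (q ^+ 2 + q + 1) * (a + b)); first by ring.
    by rewrite E0 E1 E2 q_cyc; ring.
  by move/eqP; rewrite pnatr_eq0.
have XXXX : X *m X *m (X *m X) = X by rewrite mulmxA X3 mul1mx.
(* Conjugation by [W] exchanges [X] and [X *m X], hence fixes [P]. *)
have PW : W *m P = P *m W.
  have WXX : W *m (X *m X) = X *m W by rewrite mulmxA WX -mulmxA WX mulmxA XXXX.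
  by rewrite /P !(mulmxDl, mulmxDr) mulmx1 mul1mx WX WXX addrAC.
have Q1 (s : F) : (P + s *: (P *m W)) *m X = P + s *: (P *m W).
  by rewrite mulmxDl -scalemxAl PX -[P *m W *m X]mulmxA WX !mulmxA !PX.
(* The candidates for the two signs add up to [2 P], so they cannot both vanish. *)
have [k Q0] : exists k : 'I_2, P + (-1) ^+ k *: (P *m W) != 0.
  have [E | N] := eqVneq (P + (-1) ^+ (ord0 : 'I_2) *: (P *m W)) 0; last first.
    by exists ord0.
  exists ord_max; apply: contra_neq P0 => E1.
  have n2 : (2 : F) != 0 by rewrite pnatr_eq0.
  apply: (scalerI n2); rewrite scaler0.
  transitivity ((P + (-1) ^+ (ord0 : 'I_2) *: (P *m W))
               + (P + (-1) ^+ (ord_max : 'I_2) *: (P *m W))); last by rewrite E E1 addr0.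
  by rewrite expr0 expr1 scale1r scaleN1r addrACA subrr addr0 scaler_nat.
have /rowV0Pn[v /submxP[D Dv] v0] := Q0.
exists k, v; split=> //; first by rewrite Dv -mulmxA Q1.
rewrite Dv -mulmxA [RHS]scalemxAr; congr (_ *m _).
rewrite mulmxDl -scalemxAl -mulmxA W2 mulmx1 [RHS]scalerDr scalerA.
by rewrite -expr2 sqrr_sign scale1r addrC.
Qed.

(** The rows of [A] are [v Y^2], [v], [v Y], ordered by their eigenvalues [q], [1], [q^-1]. From
    [W Y = Y^2 W] it follows that [W] swaps the outer two up to the sign [(-1)^k]. *)
Lemma clock_shift_intertwiner :
  (0 < n)%N ->
  exists (k : 'I_2) (A : 'M[F]_(3, n)),
    [/\ row_free A,
        A *m X = mx3 [:: [:: q; 0; 0]; [:: 0; 1; 0]; [:: 0; 0; q^-1]] *m A,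
        A *m Y = mx3 [:: [:: 0; 1; 0]; [:: 0; 0; 1]; [:: 1; 0; 0]] *m A &
        A *m W = ((-1) ^+ k
          *: mx3 [:: [:: 0; 0; 1]; [:: 0; 1; 0]; [:: 1; 0; 0]]) *m A].
Proof.
move=> /clock_shift_fixed_vector[k [v [v0 vX vW]]].
have q3 := cyclotomic3_cube; rewrite cyclotomic3_inv.
have YX : Y *m X = q ^+ 2 *: (X *m Y) by rewrite XY scalerA -exprSr q3 scale1r.
have q4 : q ^+ 2 * q ^+ 2 = q by rewrite -exprD (exprS q 3) q3 mulr1.
have vYX : v *m Y *m X = q ^+ 2 *: (v *m Y).
  by rewrite -mulmxA YX -scalemxAr mulmxA vX.
have vYYX : v *m Y *m Y *m X = q *: (v *m Y *m Y).
  by rewrite -mulmxA YX -scalemxAr mulmxA vYX -scalemxAl scalerA q4.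
have YYYY : Y *m Y *m (Y *m Y) = Y by rewrite mulmxA Y3 mul1mx.
have YYW : Y *m Y *m W = W *m Y by rewrite WY.
have YW : Y *m W = W *m Y *m Y by rewrite WY -mulmxA WY mulmxA YYYY.
pose A := \matrix_(i < 3) [:: v *m Y *m Y; v; v *m Y]`_i.
have A0 : row 0 A = v *m Y *m Y by rewrite rowK.
have A1 : row 1 A = v by rewrite rowK.
have A2 : row 2 A = v *m Y by rewrite rowK.
have AX : A *m X = mx3 [:: [:: q; 0; 0]; [:: 0; 1; 0]; [:: 0; 0; q ^+ 2]] *m A.
  have [m0 m1 m2] := row_mx3 [:: q; 0; 0] [:: 0; 1; 0] [:: 0; 0; q ^+ 2] A.
  by apply: row3P; rewrite ?(m0, m1, m2) row_mul ?(A0, A1, A2) /=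
    ?scale0r ?scale1r ?add0r ?addr0.
exists k, A; split=> //.
- rewrite -kermx_eq0; apply/rowV0P => u /sub_kermxP uA.
  (* A relation [u *m A = 0] can be multiplied on the right by any [B]; taking [1], [X] and [X^2]
     gives the three weighted sums that separate the eigenvectors. *)
  have uE (B : 'M_n) : u 0 0 *: (v *m Y *m Y *m B) + u 0 1 *: (v *m B)
      + u 0 2 *: (v *m Y *m B) = 0.
    rewrite -A0 -A2 -[v in X in _ + X + _]A1 -!row_mul.
    transitivity (u *m (A *m B)); last by rewrite mulmxA uA mul0mx.
    by rewrite mulmx_sum_row big_ord3.
  have [] := @cyclotomic3_eigen_independent (u 0 0 *: (v *m Y *m Y))
     (u 0 1 *: v) (u 0 2 *: (v *m Y)).
  + by have := uE 1%:M; rewrite !mulmx1.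
  + have := uE X; rewrite vYYX vX vYX !scalerA.
    by rewrite [u 0 0 * _]mulrC [u 0 2 * _]mulrC.
  + have := uE (X *m X); rewrite !mulmxA vYYX vX vX vYX -!scalemxAl vYYX vYX.
    rewrite !scalerA q4 -expr2.
    by rewrite [u 0 0 * _]mulrC [u 0 2 * _]mulrC.
  have vY0 : v *m Y != 0.
    by apply: contra_neq v0; apply: mulmxY_eq0.
  have vYY0 : v *m Y *m Y != 0.
    by apply: contra_neq vY0; apply: mulmxY_eq0.
  move=> /eqP; rewrite scaler_eq0 (negPf vYY0) orbF => /eqP u0.
  move=> /eqP; rewrite scaler_eq0 (negPf v0) orbF => /eqP u1.
  move=> /eqP; rewrite scaler_eq0 (negPf vY0) orbF => /eqP u2.
  by apply/rowP; apply: ord3_ind; rewrite mxE.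
- have [m0 m1 m2] := row_mx3 [:: 0; 1; 0] [:: 0; 0; 1] [:: 1; 0; 0] A.
  apply: row3P; rewrite ?(m0, m1, m2) row_mul ?(A0, A1, A2) /=
    ?scale0r ?scale1r ?add0r ?addr0 //.
  by rewrite -!mulmxA [Y *m (Y *m Y)]mulmxA Y3 mulmx1.
- have [m0 m1 m2] := row_mx3 [:: 0; 0; 1] [:: 0; 1; 0] [:: 1; 0; 0] A.
  rewrite -scalemxAl.
  apply: row3P; rewrite [RHS]linearZ /= ?(m0, m1, m2) row_mul ?(A0, A1, A2) /=
    ?scale0r ?scale1r ?add0r ?addr0 //.
  + by rewrite -!mulmxA [Y *m (Y *m W)]mulmxA YYW mulmxA vW scalemxAl.
  + by rewrite -mulmxA YW !mulmxA vW -!scalemxAl.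
Qed.

End ClockShift.

(** * From matrix identities to representations of the group *)

Lemma mxmodule_gen (F : fieldType) (gT : finGroupType) (G : {group gT})
    (n m : nat) (rG : mx_representation F G n) (U : 'M_(m, n)) (S : {set gT}) :
  G :=: <<S>>%g -> {in S, forall x, (U *m rG x <= U)%MS} -> mxmodule rG U.
Proof.
move=> defG stabU.
have sSG : S \subset G by rewrite defG subset_gen.
(* The stabiliser of [U] is a group, so it contains [G] once it contains [S]. *)
have sub : S \subset rstabs rG U -> mxmodule rG U by rewrite -gen_subG -defG.
by apply: sub; apply/subsetP => x Sx; rewrite inE (subsetP sSG) //= stabU.
Qed.

Theorem theorem6p4 (R : realType)
    (gT : finGroupType) (G : {group gT}) (x1 x2 a : gT)
    (hG : presented_G G x1 x2 a)
    (hT : finGroupType) (H : {group hT}) (xi1 xi2 z12 w : hT)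
    (hH : presented_RG H xi1 xi2 z12 w)
    (p : {morphism H >-> gT})
    (hp : [/\ p xi1 = x1, p xi2 = x2, p w = a & p z12 = 1%g])
    (eps : int) (heps : eps = 1 \/ eps = -1)
    (n : nat) (Pi : mx_representation R[i] H n)
    (Pi_irr : mx_irreducible Pi)
    (Pi_spin : Pi z12 = (omega R ^ eps)%:M) :
  exists (k : 'I_2) (rho : mx_representation R[i] H 3),
    is_R_rep xi1 xi2 z12 w eps k rho /\ mx_rsim Pi rho.
Proof.
have [n_gt0 irr] := (mx_irrP Pi).1 Pi_irr.
have [defH [[e1 e2 ez ew] [_ [e12 ew1 ew2]]] _] := hH.
set q := omega R ^ eps in Pi_spin *.
have q_cyc : q ^+ 2 + q + 1 = 0.
  rewrite /q; case: heps => ->; first exact: omega_cyclotomic.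
  (* For [eps = -1], [q] is [omega^2] and [q^2] is [omega^4 = omega], so the same three terms are
     summed. *)
  rewrite -[omega R ^ _]/((omega R)^-1).
  rewrite (cyclotomic3_inv (omega_cyclotomic R)) -exprM.
  rewrite (exprS _ 3) (cyclotomic3_cube (omega_cyclotomic R)) mulr1.
  by rewrite [X in X + 1]addrC omega_cyclotomic.
have [H1 H2 Hz Hw] : [/\ xi1 \in H, xi2 \in H, z12 \in H & w \in H].
  by rewrite defH; split; apply: mem_gen; rewrite !inE eqxx ?orbT.
have cube x : (x ^+ 3 = 1 -> x \in H -> Pi x *m Pi x *m Pi x = 1%:M)%g.
  by move=> x3 Hx; rewrite -!repr_mxM ?groupM // -(repr_mx1 Pi) -x3 expgS expgS mulgA.
(* As [x ^+ 3 = 1], the inverse of [x] is its square. *)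
have inv x : (x ^+ 3 = 1 -> x \in H -> w * x * w^-1 = x^-1 ->
    Pi w *m Pi x = Pi x *m Pi x *m Pi w)%g.
  move=> x3 Hx wx; rewrite -!repr_mxM ?groupM //; congr (Pi _).
  apply: (mulIg w^-1%g); rewrite wx mulgK; apply: (mulgI x).
  by rewrite mulgV -x3 expgS expgS.
have W2 : Pi w *m Pi w = 1%:M by rewrite -repr_mxM // -(repr_mx1 Pi) -ew.
have XY : Pi xi1 *m Pi xi2 = q *: (Pi xi2 *m Pi xi1).
  rewrite -mul_scalar_mx -Pi_spin -!repr_mxM ?groupM //; congr (Pi _).
  by rewrite e12 !mulgA mulgV mul1g.
have [k [A [freeA AX AY AW]]] := clock_shift_intertwiner q_cyc
  (cube _ e1 H1) (cube _ e2 H2) W2 XY (inv _ e1 H1 ew1) (inv _ e2 H2 ew2) n_gt0.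
(* For each generator, [A] times its image is a left multiple of [A], so the row space is stable. *)
have modA : mxmodule Pi A.
  apply: (mxmodule_gen defH) => x; rewrite !inE -!orbA.
  case/or4P => /eqP ->; rewrite ?AX ?AY ?AW ?submxMl //.
  by rewrite Pi_spin scalar_mxC submxMl.
have fullA : row_full A.
  (* [irr] speaks of square matrices, so [A] is replaced by [<<A>>], with the same row space; its
     rank is [3], hence nonzero. *)
  have := irr <<A>>%MS; rewrite (eqmx_module _ (genmxE A)) => /(_ modA).
  rewrite -mxrank_eq0 /row_full !genmxE; apply.
  by rewrite (eqP freeA).
have n3 : n = 3 by rewrite -(eqP fullA) (eqP freeA).
subst n.
have uA : A \in unitmx by rewrite -row_full_unit.
(* This representation is [A *m Pi x *m invmx A], so the intertwining equations give its values on
   the generators directly. *)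
exists k, (rconj_repr Pi uA); split.
  by rewrite /is_R_rep /= -invr_expz -/q; split; rewrite rconj_mxE
    ?AX ?AY ?AW ?mulmxK // Pi_spin scalar_mxC mulmxK.
apply: mx_rsim_sym; apply: (MxReprSim (B := A)) => // x Hx.
by rewrite rconj_mxE mulmxKV.
Qed.
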